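(* Let $p$ be a prime number and let ${\rm C}_p$ denote the cyclic group of order $p$. Then $p$ is a Wolstenholme prime if and only if \[ {\rm N}(\Theta({\rm C}_{p})) \equiv 1 \pmod{p^{3}}. \]
   Context: A Wolstenholme prime is a prime number $p$ satisfying $\binom{2p-1}{p-1} \equiv 1 \pmod{p^4}$. For a finite group $G$ and a family of independent commuting variables $\{x_g\}_{g\in G}$ indexed by the elements of $G$, the group determinant of $G$ is the polynomial $\Theta(G) := \det\left(x_{gh^{-1}}\right)_{g,h\in G}$ in $\mathbb{Z}[x_g : g \in G]$. For a polynomial $f$, ${\rm N}(f)$ denotes the number of terms of $f$, i.e. the number of distinct monomials appearing in $f$ with nonzero coefficient. *)

(* Defs.v *)
From HB Require Import structures.
From mathcomp Require Import all_boot all_order all_algebra all_fingroup all_solvable.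
From mathcomp Require Export mpoly.

Set Implicit Arguments.
Unset Strict Implicit.
Unset Printing Implicit Defensive.

Import GRing.Theory.

Definition Wolstenholme_prime (p : nat) : bool :=
  prime p && ('C(2 * p - 1, p - 1) == 1 %[mod p ^ 4]).

Section GroupDeterminant.

Variables (gT : finGroupType) (G : {group gT}).

(* 'I_#|G| is identified with G by enum_val, whose inverse on G is
   enum_rank_in; the default value outside G given by group1 is never used. *)
Definition group_var (g : gT) : {mpoly int[#|G|]} :=
  'X_(enum_rank_in (group1 G) g).

Definition group_matrix : 'M[{mpoly int[#|G|]}]_#|G| :=
  \matrix_(i, j) group_var (enum_val i * (enum_val j)^-1)%g.

Definition group_det : {mpoly int[#|G|]} := (\det group_matrix)%R.

End GroupDeterminant.

Definition nterms (n : nat) (R : nzRingType) (f : {mpoly R[n]}) : nat :=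
  size (msupp f).

(* Main.v *)
Require Import Defs.
From HB Require Import structures.
From mathcomp Require Import all_boot all_order all_algebra all_fingroup all_solvable.
From mathcomp Require Import mpoly.
From mathcomp Require Import all_field ring.

(** Let e label C_p by 0, .., p - 1 and let z be a primitive p-th root of unity.
    The determinant is the product over j < p of \sum_i z^(j e_i) x_i, so the
    coefficient of a monomial m of degree p is the sum of z^(\sum_j j e_(f j))
    over all words f of length p with content m.

    A cyclic shift of f multiplies its term by z^(\sum_i e_i m_i). So the
    coefficient is 0 unless p divides \sum_i e_i m_i. If p does divide it, shifts
    preserve the terms; unless f is constant the shifts act freely, so each
    power of z occurs a multiple of p times. A vanishing coefficient would force
    these multiplicities to be equal, hence p^2 to divide the number of words,
    which divides p!: impossible. Thus N counts the monomials of degree p with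
    p | \sum_i e_i m_i.

    With h_p the complete symmetric polynomial, p N is the sum over j < p of
    h_p(1, z^j, .., z^(j (p - 1))). The term j = 0 is C(2p - 1, p - 1), and the
    others are Gaussian binomials at a primitive root of unity, equal to 1.
    So p N = C(2p - 1, p - 1) + p - 1. *)

Set Implicit Arguments.
Unset Strict Implicit.
Unset Printing Implicit Defensive.

Import GRing.Theory Num.Theory.
Local Open Scope ring_scope.

(** * Words of length n, their contents, and coefficients of products of linear forms *)

Definition profile n (f : {ffun 'I_n -> 'I_n}) : 'X_{1..n} :=
  (\sum_j U_(f j))%MM.

Definition mnm_weight n (e : 'I_n -> nat) (m : 'X_{1..n}) : nat :=
  (\sum_(i < n) e i * m i)%N.

Lemma mcoeff_prod_linear (R : comNzRingType) n (c : 'I_n -> 'I_n -> R) m :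
  (\prod_j \sum_i c j i *: 'X_i : {mpoly R[n]})@_m =
  \sum_(f : {ffun 'I_n -> 'I_n} | profile f == m) \prod_j c j (f j).
Proof.
rewrite bigA_distr_bigA /= raddf_sum /= [RHS]big_mkcond /=.
apply: eq_bigr => f _.
rewrite scaler_prod mprodXE mcoeffZ mcoeffX.
by case: eqP => _; rewrite ?mulr1 ?mulr0.
Qed.

Lemma sum_expr_root n (z : algC) s : (n.-primitive_root z)%R ->
  \sum_(j < n) (z ^+ s) ^+ j = if (n %| s)%N then n%:R else 0.
Proof.
move=> prim; have n_gt0 := prim_order_gt0 prim.
rewrite (prim_order_dvd prim); case: eqP => [->|/eqP nz].
  under eq_bigr => j _ do rewrite expr1n.
  by rewrite sumr_const card_ord.
have := subrX1 (z ^+ s) n; rewrite exprAC (prim_expr_order prim) expr1n subrr.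
move/esym/eqP; rewrite mulf_eq0 subr_eq0 (negPf nz) /= => /eqP; exact.
Qed.

Lemma mdeg_profile n (f : {ffun 'I_n -> 'I_n}) : mdeg (profile f) = n.
Proof.
rewrite /profile mdeg_sum.
under eq_bigr => j _ do rewrite mdeg1.
by rewrite sum_nat_const card_ord muln1.
Qed.

Lemma profileE n (f : {ffun 'I_n -> 'I_n}) i :
  profile f i = #|[set j | f j == i]|.
Proof.
rewrite /profile mnm_sumE -sum1_card [RHS]big_mkcond /=.
by apply: eq_bigr => j _; rewrite inE mnm1E; case: eqP.
Qed.

Lemma sum_profile n (f : {ffun 'I_n -> 'I_n}) (e : 'I_n -> nat) :
  mnm_weight e (profile f) = (\sum_j e (f j))%N.
Proof.
rewrite /mnm_weight /profile.
under [LHS]eq_bigr => i _ do rewrite mnm_sumE big_distrr /=.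
rewrite exchange_big /=; apply: eq_bigr => j _.
rewrite (bigD1 (f j)) //= mnm1E eqxx muln1 big1 ?addn0 // => i ne.
by rewrite mnm1E eq_sym (negPf ne) muln0.
Qed.

(** * The symmetric group acting on the positions of a word *)

Section Reindexing.
Variable n : nat.
Implicit Types (f g : {ffun 'I_n -> 'I_n}) (s : {perm 'I_n}).

(** The inverse makes this a right action for the product of permutations. *)
Definition reindex_ffun f s : {ffun 'I_n -> 'I_n} := [ffun j => f (s^-1 j)%g].

Lemma reindex_ffun1 : reindex_ffun^~ 1%g =1 id.
Proof. by move=> f; apply/ffunP => j; rewrite ffunE invg1 perm1. Qed.

Lemma reindex_ffunM f : act_morph reindex_ffun f.
Proof. by move=> s t; apply/ffunP => j; rewrite !ffunE invMg permM. Qed.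

Canonical reindex_action := TotalAction reindex_ffun1 reindex_ffunM.

Lemma profile_reindex f s : profile (reindex_ffun f s) = profile f.
Proof.
rewrite /profile (reindex_inj (@perm_inj _ s)) /=.
by apply: eq_bigr => j _; rewrite ffunE permK.
Qed.

(** Words of equal content are rearrangements of each other, so a content class is a single orbit
    and its size divides n!. *)
Lemma profile_eq_orbit f :
  [set g | profile g == profile f] = orbit reindex_action [set: {perm 'I_n}] f.
Proof.
apply/setP => g; rewrite inE; apply/eqP/orbitP => [eq_gf|[s _ <-]]; last first.
  exact: profile_reindex.
have : perm_eq (mktuple g) (mktuple f).
  apply/allP => i _ /=; apply/eqP.
  have cnt (h : {ffun 'I_n -> 'I_n}) : count_mem i (mktuple h) = profile h i.
    rewrite profileE cardsE cardE size_filter /= count_map enumT.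
    exact/eq_count.
  by rewrite !cnt eq_gf.
case/tuple_permP => s eq_s; exists s^-1%g; first by rewrite inE.
apply/ffunP => j; rewrite ffunE invgK.
have /(congr1 (fun t => nth j t j)) := eq_s.
by rewrite -!tnth_nth !tnth_mktuple.
Qed.

Lemma card_profile_dvd f : (#|[set g | profile g == profile f]| %| n`!)%N.
Proof.
rewrite profile_eq_orbit; apply: dvdn_trans (dvdn_orbit _ _ _) _.
by rewrite cardsT card_Sn.
Qed.

End Reindexing.

(** The minimal polynomial of z over the rationals is cyclotomic of degree p - 1. Both \sum_k B_k
    X^k and 1 + X + .. + X^(p - 1) vanish at z and have degree below p, so they are proportional.
    Hence all B_k are equal. *)
Lemma prime_sum_coef_dvd p (z : algC) (B : 'I_p -> nat) :
  prime p -> p.-primitive_root z -> \sum_k (B k)%:R * z ^+ k = 0 ->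
  (p %| \sum_k B k)%N.
Proof.
move=> p_pr prim sumB.
pose Q : {poly rat} := \poly_(k < p) (if insub k is Some i then (B i)%:R else 0).
have QE (k : 'I_p) : Q`_k = (B k)%:R by rewrite coef_poly ltn_ord valK.
have [q [Dq q_mon] min_q] := minCpolyP z.
have szq : size q = p.
  rewrite -(size_map_poly (ratr : {rmorphism rat -> algC}) q) -Dq.
  by rewrite (minCpoly_cyclotomic prim) size_cyclotomic totient_prime //
     prednK ?prime_gt0.
pose S : {poly rat} := \poly_(k < p) 1.
have rootP (c : 'I_p -> rat) (P : {poly rat}) : (size P <= p)%N ->
    (forall k : 'I_p, P`_k = c k) -> \sum_k ratr (c k) * z ^+ k = 0 ->
    exists a, P = a *: q.
  move=> szP Pc sum0; have : root (map_poly ratr P) z.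
    rewrite /root (@horner_coef_wide _ p) ?size_map_poly // -[X in _ == X]sum0.
    by apply/eqP/eq_bigr => k _; rewrite coef_map /= Pc.
  rewrite min_q => /dvdpP [a Pa].
  have [->|nz] := eqVneq P 0; first by exists 0; rewrite scale0r.
  have anz : a != 0 by apply: contraNneq nz => a0; rewrite Pa a0 mul0r.
  have := size_mul anz (monic_neq0 q_mon); rewrite -Pa szq => szPa.
  (* P has size at most p, the size of q, so the cofactor is a constant. *)
  exists a`_0; rewrite Pa -mul_polyC; congr (_ * _); apply: size1_polyC.
  by rewrite szPa -subn1 leq_subLR leq_add2r in szP.
have [a QaE] : exists a, Q = a *: q.
  apply: (rootP (fun k => (B k)%:R)) => //; first exact: size_poly.
  by rewrite -[RHS]sumB; apply: eq_bigr => k _; rewrite ratr_nat.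
have [b SbE] : exists b, S = b *: q.
  apply: (rootP (fun k => 1)); first exact: size_poly.
    by move=> k; rewrite coef_poly ltn_ord.
  have := sum_expr_root 1 prim; rewrite dvdn1 gtn_eqF ?prime_gt1 // => {2}<-.
  by apply: eq_bigr => k _; rewrite rmorph1 mul1r expr1.
have b_nz : b != 0.
  apply/eqP => b0; have := QE; have : S`_0 = 1 by rewrite coef_poly prime_gt0.
  by rewrite SbE b0 scale0r coef0 => /eqP; rewrite eq_sym oner_eq0.
have QS : Q = (a / b) *: S by rewrite SbE scalerA divfK.
pose k0 := Ordinal (prime_gt0 p_pr).
have Bconst k : B k = B k0.
  apply/eqP; rewrite -(eqr_nat rat) -!QE QS !coefZ !coef_poly ltn_ord.
  by rewrite (prime_gt0 p_pr).
under eq_bigr => k _ do rewrite Bconst.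
by rewrite sum_nat_const card_ord dvdn_mulr.
Qed.

(** * Sums of powers of z over the words of a given content *)

Section WeightedReindexing.
Variables (n : nat) (e : 'I_n -> nat).
Implicit Types (f g : {ffun 'I_n -> 'I_n}) (m : 'X_{1..n}).

Definition weight f : nat := (\sum_(j < n) j * e (f j))%N.

Definition ord_shift : {perm 'I_n} := perm (@ordS_inj n).

Lemma ord_shift_expE k (j : 'I_n) : (ord_shift ^+ k)%g j = ((j + k) %% n)%N :> nat.
Proof.
rewrite permX; elim: k => [|k IHk] /=; first by rewrite addn0 modn_small.
by rewrite permE /= IHk -addn1 modnDml addn1 addnS.
Qed.

Lemma ord_shift_exp_card : (ord_shift ^+ n = 1)%g.
Proof.
apply/permP => j; apply: val_inj.
by rewrite /= ord_shift_expE modnDr modn_small // perm1.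
Qed.

(** Each letter moves from position j to j + 1 and contributes one more e (f j). The wrap-around
    from n - 1 to 0 only costs a multiple of n. *)
Lemma weight_reindex_shift f :
  weight (reindex_ffun f ord_shift) = (weight f + \sum_j e (f j))%N %[mod n].
Proof.
rewrite /weight (reindex_inj (@perm_inj _ ord_shift)) /= -big_split /=.
rewrite -modn_summ -[RHS]modn_summ; congr (_ %% n)%N.
apply: eq_bigr => j _; rewrite ffunE permK permE /=.
by rewrite modnMml mulSn addnC.
Qed.

Lemma sum_expr_weight_eq0 (z : algC) m :
    n.-primitive_root z -> ~~ (n %| mnm_weight e m)%N ->
  \sum_(f | profile f == m) z ^+ weight f = 0.
Proof.
move=> prim ndvd; set S := LHS.
have : S = z ^+ mnm_weight e m * S.
  rewrite {1}/S (reindex_inj (act_inj (reindex_action n) ord_shift)) /=.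
  rewrite big_distrr /=; apply: eq_big => f; first by rewrite profile_reindex.
  rewrite profile_reindex => /eqP <-.
  rewrite sum_profile -exprD addnC; apply/eqP.
  by rewrite (eq_prim_root_expr prim) weight_reindex_shift.
move/eqP; rewrite -subr_eq0 -{1}[S]mul1r -mulrBl mulf_eq0 subr_eq0 eq_sym.
by rewrite -(prim_order_dvd prim) (negPf ndvd) => /eqP.
Qed.

(** The shift generates an n-group acting on this set, so the cardinal is congruent mod n to the
    number of fixed words. A fixed word is constant, and so would be f, its rearrangement. *)
Lemma card_profile_weight_dvd f k :
    prime n -> (n %| \sum_j e (f j))%N -> ~~ [exists i, f == [ffun=> i]] ->
  (n %| #|[set g | (profile g == profile f) && (weight g == k %[mod n])]|)%N.
Proof.
move=> n_pr dvd nconst; set A := [set g | _].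
have n_group : (n.-group <[ord_shift]>)%g.
  rewrite /pgroup; apply: (@pnat_dvd _ n); last by rewrite pnat_id.
  by rewrite -orderE order_dvdn ord_shift_exp_card.
have actA : [acts <[ord_shift]>%g, on A | reindex_action n].
  rewrite cycle_subG; apply/astabsP => g; rewrite !inE /= profile_reindex.
  case: eqP => //= eq_gf; rewrite weight_reindex_shift -sum_profile eq_gf sum_profile.
  by rewrite -modnDmr (eqP dvd) addn0.
have := pgroup_fix_mod n_group actA.
rewrite afix_cycle (_ : 'Fix_(A | _)[_]%g = set0) ?cards0 ?mod0n.
  by move/eqP.
apply/setP => g; rewrite !inE; apply/negbTE; apply: contra nconst.
case/andP => /andP[/eqP eq_gf _]; rewrite sub1set inE => /eqP /= fix_g.
have g_shift l j : g ((ord_shift ^+ l)%g j) = g j.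
  elim: l => [|l IHl]; first by rewrite perm1.
  by rewrite -{1}fix_g expgSr permM ffunE permK.
pose j0 := Ordinal (prime_gt0 n_pr).
have gE j : g j = g j0.
  rewrite -(g_shift j j0); congr (g _); apply: val_inj.
  by rewrite /= ord_shift_expE add0n modn_small.
have : f \in [set h | profile h == profile g] by rewrite inE eq_gf.
rewrite profile_eq_orbit => /orbitP[s _ <-].
by apply/existsP; exists (g j0); apply/eqP/ffunP => j; rewrite !ffunE gE.
Qed.

Lemma sum_expr_weight_neq0 (z : algC) f :
    prime n -> n.-primitive_root z -> (n %| \sum_j e (f j))%N ->
  \sum_(g | profile g == profile f) z ^+ weight g != 0.
Proof.
move=> n_pr prim dvd.
have [/existsP[i /eqP fE]|nconst] := boolP [exists i, f == [ffun=> i]].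
  have z_nz : z != 0.
    have := oner_neq0 algC; rewrite -(prim_expr_order prim) expf_eq0.
    by rewrite prime_gt0.
  rewrite (big_pred1 f) ?expf_neq0 // => g /=.
  (* A constant word is its only rearrangement, so the sum is a single power of z. *)
  apply/idP/eqP => [|->]; last exact: eqxx.
  have -> : (profile g == profile f) = (g \in [set h | profile h == profile f]).
    by rewrite inE.
  rewrite profile_eq_orbit => /orbitP[s _ <-].
  by apply/ffunP => j; rewrite fE !ffunE.
pose A k := #|[set g | (profile g == profile f) && (weight g == k %[mod n])]|.
pose r g := Ordinal (ltn_pmod (weight g) (prime_gt0 n_pr)).
have sumA : \sum_(k < n) (A k)%:R * z ^+ k
          = \sum_(g | profile g == profile f) z ^+ weight g.
  rewrite [RHS](partition_big r xpredT) //=; apply: eq_bigr => k _.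
  rewrite mulr_natl -sumr_const; apply: eq_big => g; last first.
    rewrite inE => /andP[_ /eqP wk]; apply/esym/eqP.
    by rewrite (eq_prim_root_expr prim) wk.
  by rewrite inE -val_eqE /= [(k %% n)%N]modn_small.
have cardA : (\sum_(k < n) A k = #|[set g | profile g == profile f]|)%N.
  rewrite -[RHS]sum1_card (partition_big r xpredT) //=; apply: eq_bigr => k _.
  rewrite /A -sum1_card; apply: eq_bigl => g.
  by rewrite !inE -val_eqE /= [(k %% n)%N]modn_small.
have dvdA k : (n %| A k)%N by apply: card_profile_weight_dvd.
rewrite -sumA; apply/negP => /eqP sum0.
have : (n ^ 2 %| n`!)%N.
  apply: dvdn_trans (card_profile_dvd f); rewrite -cardA.
  under eq_bigr => k _ do rewrite -(divnK (dvdA k)).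
  rewrite -big_distrl /= dvdn_pmul2r ?prime_gt0 //.
  (* The lemma is applied to the quotients [A k %/ n], which yields the second factor n. *)
  apply: prime_sum_coef_dvd prim _ => //.
  have n_nz : n%:R != 0 :> algC by rewrite pnatr_eq0 -lt0n prime_gt0.
  apply: (mulIf n_nz); rewrite mul0r -[RHS]sum0 big_distrl /=.
  by apply: eq_bigr => k _; rewrite mulrAC -natrM divnK.
rewrite -[n in n`!](prednK (prime_gt0 n_pr)) factS prednK ?prime_gt0 //.
rewrite dvdn_pmul2l ?prime_gt0 // => dvd_fact.
(* By Wilson n divides (n - 1)! + 1, so it cannot divide (n - 1)!. *)
have := Wilson (prime_gt1 n_pr); rewrite n_pr -addn1 dvdn_addr // dvdn1.
by rewrite gtn_eqF ?prime_gt1.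
Qed.

Lemma profile_surj m : mdeg m = n -> exists f, profile f = m.
Proof.
move=> degm; have sz : size (m2s m) == n by rewrite size_m2s degm.
exists [ffun j => tnth (Tuple sz) j]; apply/mnmP => i.
rewrite profileE -[in RHS](s2mK m) mnmE cardsE.
rewrite -[X in count _ X](map_tnth_enum (Tuple sz)) count_map cardE size_filter.
rewrite enumT; apply: eq_count => j /=.
by rewrite unfold_in ffunE.
Qed.

Lemma sum_expr_weight_eq0E (z : algC) m :
    prime n -> n.-primitive_root z ->
  (\sum_(f | profile f == m) z ^+ weight f != 0) =
    (mdeg m == n) && (n %| mnm_weight e m)%N.
Proof.
move=> n_pr prim; have [/profile_surj[f <-]|degm] := eqVneq (mdeg m) n.
  have [dvd|ndvd] := boolP (n %| _)%N; last first.
    by rewrite sum_expr_weight_eq0 ?eqxx.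
  by rewrite sum_expr_weight_neq0 // -sum_profile.
rewrite [X in X != 0]big_pred0 ?eqxx // => f.
by apply: contraNF degm => /eqP <-; rewrite mdeg_profile.
Qed.
End WeightedReindexing.

(** * Complete symmetric polynomials at powers of q *)

Section BoundedDegreeCount.
Variables (n b : nat) (e : 'I_n -> nat).
Hypotheses (e_inj : injective e) (e_lt : forall i, (e i < n)%N).
Implicit Type m : 'X_{1..n < b}.

(** For r <= n and k < b this is h_k(1, q, .., q^(r - 1)): the variables with e i >= r are excluded.
    The degree bound b only serves to make the index type finite. *)
Definition complete_sum (R : comNzRingType) (q : R) r k : R :=
  \sum_(m : 'X_{1..n < b} |
      (mdeg m == k) && [forall i, (r <= e i)%N ==> (m i == 0%N)])
    q ^+ mnm_weight e m.

Lemma mnm_weightD (m1 m2 : 'X_{1..n}) :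
  mnm_weight e (m1 + m2)%MM = (mnm_weight e m1 + mnm_weight e m2)%N.
Proof.
by rewrite -big_split; apply: eq_bigr => i _; rewrite mnmDE mulnDr.
Qed.

Lemma mnm_weight1 i : mnm_weight e U_(i) = e i.
Proof.
rewrite /mnm_weight (bigD1 i) //= mnm1E eqxx muln1 big1 ?addn0 // => j ne.
by rewrite mnm1E eq_sym (negPf ne) muln0.
Qed.

Lemma mnm_weight0 : mnm_weight e 0%MM = 0%N.
Proof. by rewrite /mnm_weight big1 // => i _; rewrite mnm0E muln0. Qed.

Lemma weight_surj r : (r < n)%N -> exists i, e i = r.
Proof.
move=> ltr; pose f i := Ordinal (e_lt i).
have f_inj : injective f by move=> i j /(congr1 val) /e_inj.
have [g _ fK] := injF_bij f_inj.
by exists (g (Ordinal ltr)); rewrite -[LHS]/(val (f _)) fK.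
Qed.

Variables (R : comNzRingType) (q : R).
Local Notation H := (complete_sum q).

Lemma complete_sum_deg0 r : (0 < b)%N -> H r 0 = 1.
Proof.
move=> b_gt0; have lt0 : (mdeg (0%MM : 'X_{1..n}) < b)%N by rewrite mdeg0.
rewrite /complete_sum (big_pred1 (BMultinom lt0)) /= ?mnm_weight0 // => m.
rewrite mdeg_eq0 -[RHS]val_eqE /=; case: eqP => //= ->.
by apply/forallP => i; rewrite mnm0E implybT.
Qed.

Lemma complete_sum_range0 k : H 0 k.+1 = 0.
Proof.
rewrite /complete_sum big_pred0 // => m; apply/negbTE/negP => /andP[/eqP degm].
move=> /forallP m0; suff: val m = 0%MM by move/eqP; rewrite -mdeg_eq0 degm.
by apply/mnmP => i; rewrite mnm0E; apply/eqP/(implyP (m0 i)).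
Qed.

(** The monomials are split by whether the variable of value q^r occurs. If it does, one copy is
    factored out. *)
Lemma complete_sumS r k : (r < n)%N -> (k.+1 < b)%N ->
  H r.+1 k.+1 = H r k.+1 + q ^+ r * H r.+1 k.
Proof.
move=> /weight_surj[i0 e_i0] ltkb.
rewrite {1}/complete_sum (bigID (fun m => m i0 == 0%N)) /=; congr (_ + _).
  apply: eq_bigl => m; rewrite -andbA; congr (_ && _).
  apply/andP/forallP => [[/forallP m0 mi0] i|m0].
    rewrite leq_eqVlt; case: eqP => [re|_]; last exact: m0.
    by rewrite (_ : i = i0) //; apply: e_inj; rewrite e_i0.
  split; last by have := m0 i0; rewrite e_i0 leqnn.
  by apply/forallP => i; apply/implyP => /ltnW; apply/implyP.
(* [h] multiplies by the variable [i0] and [h'] divides by it. The default of [insubd] in [h] is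
   reached only when the degree bound is exceeded, and there [h' (h m) == m] fails once [h m i0] is
   nonzero. *)
pose h m := insubd m (m + U_(i0))%MM; pose h' m := insubd m (m - U_(i0))%MM.
have valh m : mdeg m = k -> val (h m) = (m + U_(i0))%MM.
  by move=> degm; rewrite val_insubd mdegD mdeg1 degm addn1 ltkb.
have valh' m : val (h' m) = (m - U_(i0))%MM.
  by rewrite val_insubd (leq_ltn_trans (mdegB _ _)) ?bmdeg.
have U_le m : m i0 != 0%N -> (U_(i0) <= m)%MM.
  by move=> mi0; apply/mnm_lepP => i; rewrite mnm1E; case: eqP => // <-; rewrite lt0n.
rewrite (reindex_onto h h') /=; last first.
  move=> m /andP[/andP[/eqP degm _] /U_le le_m].
  have deg' : mdeg (val (h' m)) = k.
    apply/eqP; rewrite -(eqn_add2r 1) [(k + 1)%N]addn1 -degm valh' -(mdeg1 i0) -mdegD.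
    by rewrite submK.
  by apply: val_inj; rewrite valh // valh' submK.
have supp_add m : [forall i, (r < e i)%N ==> ((m + U_(i0))%MM i == 0%N)] =
                  [forall i, (r < e i)%N ==> (m i == 0%N)].
  apply: eq_forallb => i; rewrite mnmDE mnm1E.
  case: (i0 =P i) => [<-|_] /=; last by rewrite addn0.
  by rewrite e_i0 ltnn.
have condE m : [&& mdeg (h m) == k.+1, [forall i, (r < e i)%N ==> (h m i == 0%N)],
      h m i0 != 0%N & h' (h m) == m] =
    (mdeg m == k) && [forall i, (r < e i)%N ==> (m i == 0%N)].
  apply/and4P/andP => [[/eqP degh supph hi0 /eqP hK]|[/eqP degm suppm]].
    have hmE : (h m : 'X_{1..n}) = (m + U_(i0))%MM.
      by rewrite -{2}hK valh' submK ?U_le.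
    move: degh supph; rewrite hmE supp_add mdegD mdeg1 addn1 => -[->] ->.
    by rewrite eqxx.
  have hmE := valh _ degm; split.
  - by rewrite hmE mdegD mdeg1 degm addn1.
  - by rewrite hmE supp_add.
  - by rewrite hmE mnmDE mnm1E eqxx addn1.
  - by apply/eqP/val_inj; rewrite valh' hmE addmK.
rewrite /complete_sum big_distrr /=; apply: eq_big => m.
  by rewrite -condE !andbA.
rewrite -!andbA condE => /andP[/eqP degm _].
rewrite valh //.
by rewrite mnm_weightD mnm_weight1 e_i0 exprD mulrC.
Qed.

(** Product formula for the Gaussian binomial of k + r over r, cleared of denominators so that q may
    be a root of unity. The proof is a double induction through the recurrence. *)
Lemma complete_sum_prod r k : (r < n)%N -> (k < b)%N ->
  H r.+1 k * \prod_(1 <= i < r.+1) (1 - q ^+ i) =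
    \prod_(1 <= i < r.+1) (1 - q ^+ (k + i)).
Proof.
elim: r k => [|r IHr] k ltrn ltkb.
  rewrite !big_geq // mulr1; elim: k ltkb => [|k IHk] ltkb.
    by rewrite complete_sum_deg0.
  by rewrite complete_sumS // complete_sum_range0 add0r expr0 mul1r IHk // ltnW.
elim: k ltkb => [|k IHk] ltkb; first by rewrite complete_sum_deg0 // mul1r.
rewrite complete_sumS // mulrDl -mulrA IHk; last exact: ltnW.
rewrite big_nat_recr //= mulrA IHr //; last exact: ltnW.
rewrite [X in _ + q ^+ _ * X]big_nat_recl //= [RHS]big_nat_recr //=.
under [X in _ + q ^+ _ * (_ * X)]eq_bigr => i _ do rewrite addnS -addSn.
(* With T factored out there remains (1 - q^(r+1)) + q^(r+1) (1 - q^(k+1)) = 1 - q^(k+r+2). *)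
set T := \prod_(1 <= i < r.+1) _; rewrite addn1 addSnnS.
by rewrite exprD !exprS; ring.
Qed.

End BoundedDegreeCount.

(** * Counting the monomials of degree n whose weight is divisible by n *)

Section ZeroWeightCount.
Variables (n : nat) (e : 'I_n -> nat).
Hypotheses (e_inj : injective e) (e_lt : forall i, (e i < n)%N).

Local Notation H q := (complete_sum n.+1 e q).

(** At q = 1 the recurrence is Pascal's rule. *)
Lemma complete_sum_card (r k : nat) : (r < n)%N -> (k <= n)%N ->
  H (1 : algC) r.+1 k = 'C(r + k, k)%:R.
Proof.
elim: r k => [|r IHr] k ltrn; elim: k => [|k IHk] lekn.
- by rewrite complete_sum_deg0.
- rewrite complete_sumS // complete_sum_range0 add0r expr1n mul1r IHk 1?ltnW //.
  by rewrite !add0n !binn.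
- by rewrite complete_sum_deg0 // bin0.
rewrite complete_sumS // expr1n mul1r IHk 1?ltnW // (IHr _ (ltnW ltrn) lekn).
by rewrite -natrD !addSn addnS binS.
Qed.

(** For k = n the two products of the formula agree since z^(n + i) = z^i, and no factor vanishes
    for 0 < i < n. *)
Lemma complete_sum_primitive (z : algC) :
  n.-primitive_root z -> H z n n = 1.
Proof.
move=> prim; have n_gt0 := prim_order_gt0 prim.
have := @complete_sum_prod n n.+1 e e_inj e_lt _ z n.-1 n.
rewrite prednK // => /(_ (leqnn _) (leqnn _)).
under [RHS]eq_bigr => i _ do
  rewrite exprD (prim_expr_order prim) mul1r.
rewrite -[RHS]mul1r; apply: mulIf.
rewrite prodf_seq_neq0; apply/allP => i; rewrite mem_index_iota => /andP[i0 ltin].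
by rewrite /= subr_eq0 eq_sym -(prim_order_dvd prim) gtnNdvd.
Qed.

Lemma card_mnm_weight0 (z : algC) : prime n -> n.-primitive_root z ->
  (n * #|[set m : 'X_{1..n < n.+1} |
            (mdeg m == n) && (n %| mnm_weight e m)]|)%N
    = ('C(2 * n - 1, n - 1) + (n - 1))%N.
Proof.
move=> n_pr prim; have n_gt0 := prime_gt0 n_pr.
apply/eqP; rewrite -(eqr_nat algC); apply/eqP.
have fullH q : H q n n = \sum_(m : 'X_{1..n < n.+1} | mdeg m == n)
                            q ^+ mnm_weight e m.
  apply: eq_bigl => m; rewrite [X in _ && X](_ : _ = true) ?andbT //.
  by apply/forallP => i; rewrite leqNgt e_lt.
(* Roots of unity filter: summing z^(j w) over j gives n if n divides w and 0 otherwise. *)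
transitivity (\sum_(j < n) H (z ^+ j) n n).
  under [RHS]eq_bigr => j _ do rewrite fullH.
  rewrite exchange_big /= natrM -sum1_card natr_sum big_distrr /= big_mkcond.
  rewrite [RHS]big_mkcond; apply: eq_bigr => m _; rewrite inE.
  case: (mdeg m == n) => //=.
  under [RHS]eq_bigr => j _ do rewrite exprAC.
  by rewrite sum_expr_root //; case: ifP; rewrite ?mulr1.
rewrite (bigD1 (Ordinal n_gt0)) //= expr0.
have -> : H (1 : algC) n n = 'C(2 * n - 1, n - 1)%:R.
  have := @complete_sum_card n.-1 n; rewrite prednK // => -> //.
  by rewrite -(bin_sub (leq_addl n.-1 n)) addnK mul2n -addnn -!subn1 addnBAC.
rewrite (eq_bigr (fun=> 1)) => [|j nz_j]; last first.
  (* As n is prime, z^j is again primitive for 0 < j < n. *)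
  apply: complete_sum_primitive; rewrite (prim_root_exp_coprime _ prim).
  rewrite coprime_sym prime_coprime // gtnNdvd ?lt0n //.
by rewrite sumr_const natrD cardC1 card_ord -!subn1.
Qed.

End ZeroWeightCount.

(** * The determinant of a cyclic group and its number of terms *)

Section CyclicGroupDeterminant.
Variables (gT : finGroupType) (G : {group gT}).
Local Notation n := #|G|.

(** Discrete logarithms to base c: the enumeration of G need not follow the powers of c. *)
Lemma cyclic_logs (c : gT) : G :=: <[c]>%g ->
  exists2 e : 'I_n -> nat, injective e &
    forall i, (e i < n)%N /\ enum_val i = (c ^+ e i)%g.
Proof.
move=> defG; pose e (i : 'I_n) := odflt i [pick k : 'I_n | enum_val i == (c ^+ k)%g].
have eE i : enum_val i = (c ^+ e i)%g.
  rewrite /e; case: pickP => [k /eqP //|no_k].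
  have : enum_val i \in <[c]>%g by rewrite -defG enum_valP.
  case/cyclePmin => k; rewrite /order -defG => ltk vE.
  by have := no_k (Ordinal ltk); rewrite /= vE eqxx.
exists (fun i => val (e i)) => [i j eij|i]; last by rewrite ltn_ord eE.
by apply: enum_val_inj; rewrite !eE eij.
Qed.

(** The Vandermonde matrix of the characters, with entries z^(j e_i), diagonalizes the group matrix.
    Its determinant is nonzero and cancels. *)
Lemma group_det_prod (c : gT) (z : algC) (e : 'I_n -> nat) :
    G :=: <[c]>%g -> n.-primitive_root z -> injective e ->
    (forall i, (e i < n)%N /\ enum_val i = (c ^+ e i)%g) ->
  map_mpoly (intr : int -> algC) (group_det G) =
    \prod_(j < n) \sum_i z ^+ (j * e i) *: 'X_i.
Proof.
move=> defG prim e_inj eP.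
pose V := Vandermonde n (\row_i z ^+ e i).
have V_nz : \det V != 0.
  rewrite det_Vandermonde; apply/prodf_neq0 => i _; apply/prodf_neq0 => j ltij.
  rewrite !mxE subr_eq0 (eq_prim_root_expr prim) !modn_small ?(proj1 (eP _)) //.
  by rewrite (inj_eq e_inj) -val_eqE gtn_eqF.
pose W := map_mx (@mpolyC n algC : {rmorphism algC -> {mpoly algC[n]}}) V.
have W_nz : \det W != 0 by rewrite det_map_mx mpolyC_eq0.
pose M := map_mx (map_mpoly (intr : int -> algC)) (group_matrix G).
pose d : 'rV_n := \row_j \sum_i z ^+ (j * e i) *: 'X_i.
have WM : W *m M = diag_mx d *m W.
  apply/matrixP => j b; rewrite mul_diag_mx !mxE mulr_suml.
  (* The sum is reindexed by a = i b, so that the matrix entry at (a, b) becomes the variable of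
     i. *)
  have h_inj : injective (fun i : 'I_n =>
      enum_rank_in (group1 G) (enum_val i * enum_val b)%g).
    move=> i1 i2 /(congr1 enum_val).
    by rewrite !enum_rankK_in ?groupM ?enum_valP // => /mulIg /enum_val_inj.
  rewrite (reindex_inj h_inj); apply: eq_bigr => i _; rewrite !mxE.
  set a := enum_rank_in _ _.
  have va : enum_val a = (enum_val i * enum_val b)%g.
    by rewrite enum_rankK_in ?groupM ?enum_valP.
  rewrite /group_var va mulgK enum_valK_in map_mpolyX.
  have -> : z ^+ e a = z ^+ (e i + e b).
    apply/eqP; rewrite (eq_prim_root_expr prim) defG.
    rewrite -[#|_|]/(#[c]%g) -eq_expg_mod_order expgD.
    by rewrite -!(proj2 (eP _)) va.
  rewrite [RHS]mulrC !mul_mpolyC scalerA -!exprM -exprD.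
  by rewrite mulnDl addnC [(e i * j)%N]mulnC.
rewrite -[LHS]det_map_mx -/M.
apply: (mulfI W_nz); rewrite -det_mulmx WM det_mulmx mulrC det_diag.
by congr (_ * _); apply: eq_bigr => j _; rewrite mxE.
Qed.

Lemma nterms_group_det : prime n -> cyclic G ->
  (n * nterms (group_det G) = 'C(2 * n - 1, n - 1) + (n - 1))%N.
Proof.
move=> n_pr /cyclicP[c defG].
have [e e_inj eP] := cyclic_logs defG.
have [z prim] := C_prim_root_exists (prime_gt0 n_pr).
rewrite -(card_mnm_weight0 e_inj (fun i => proj1 (eP i)) n_pr prim).
congr (_ * _)%N; rewrite [RHS]cardE -[RHS](size_map val).
apply/perm_size/uniq_perm; first exact: msupp_uniq.
  by rewrite map_inj_uniq ?enum_uniq //; apply: val_inj.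
move=> m; rewrite mcoeff_msupp.
have suppE : ((group_det G)@_m != 0) =
    (mdeg m == n) && (n %| mnm_weight e m)%N.
  rewrite -(sum_expr_weight_eq0E e m n_pr prim) -(intr_eq0 algC).
  rewrite -mcoeff_map_mpoly (group_det_prod defG prim e_inj eP).
  rewrite (mcoeff_prod_linear (fun j i => z ^+ (j * e i))).
  by under eq_bigr => f _ do rewrite prodrXr.
rewrite suppE; apply/idP/mapP => [/andP[degm dvdm]|[m' + ->]].
  have ltm : (mdeg m < n.+1)%N by rewrite (eqP degm).
  by exists (BMultinom ltm); rewrite // mem_enum inE degm.
by rewrite mem_enum inE.
Qed.

End CyclicGroupDeterminant.

Local Close Scope ring_scope.

Theorem theorem2 (p : nat) (p_pr : prime p)
    (gT : finGroupType) (G : {group gT}) (cycG : cyclic G) (oG : #|G| = p) :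
  Wolstenholme_prime p <-> nterms (group_det G) = 1 %[mod p ^ 3].
Proof.
subst p; have n_gt0 := prime_gt0 p_pr.
(* Adding p - 1 to both sides turns the congruence into p N = p mod p^4, and p cancels. *)
rewrite /Wolstenholme_prime p_pr /= -(eqn_modDr (#|G| - 1)) subnKC //.
rewrite -nterms_group_det // -[X in _ == X %[mod _]]muln1 (expnS _ 3).
by rewrite -!muln_modr eqn_pmul2l //; split => /eqP.
Qed.
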